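(* Let $\Gamma$ be a finitely generated abelian group, $\mathcal{A}$ a finite list of elements of $\Gamma$, and $G=(\mathbb{S}^1)^p\times\mathbb{R}^q\times F$ with $p,q\ge0$ integers, $F$ a finite abelian group, and $g=p+q\in\mathbb{Z}_{>0}$. Then $$\chi^{\mathrm{par}}_{\mathcal{A}(G)}(t)=\chi^G_{\mathcal{A}}\big(\#F\cdot t^g\big).$$
   Context: $G$ is written additively with its usual Lie group topology ($F$ discrete); $T=\operatorname{Hom}(\Gamma,G)$. For $\alpha\in\mathcal{A}$, $H_{\alpha,G}=\{\varphi\in T\mid\varphi(\alpha)=0\}$; for a sublist $\mathcal{S}\subseteq\mathcal{A}$, $H_{\mathcal{S},G}=\bigcap_{\alpha\in\mathcal{S}}H_{\alpha,G}$ ($H_{\emptyset,G}=T$); each connected component of $H_{\mathcal{S},G}$ is a manifold of dimension $g(r_\Gamma-r_{\mathcal{S}})$, where $r_{\mathcal{S}}$ is the rank of the subgroup $\langle\mathcal{S}\rangle$ generated by $\mathcal{S}$ and $r_\Gamma$ the rank of $\Gamma$. The total intersection poset $L$ is the set of connected components of all nonempty $H_{\mathcal{S},G}$, $\mathcal{S}\subseteq\mathcal{A}$, ordered by reverse inclusion, with Möbius function $\mu$. For $\mathcal{C}\in L$, $T^{\mathcal{C}}$ is the connected component of $T$ containing $\mathcal{C}$. Let $\Gamma_{\operatorname{tor}}$ be the torsion subgroup and $\mathcal{A}^{\operatorname{tor}}=\mathcal{A}\cap\Gamma_{\operatorname{tor}}$; $\mathrm{scc}(T)$ is the set of connected components $T_i$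 of $T$ with no $\alpha\in\mathcal{A}^{\operatorname{tor}}$ such that $T_i\subseteq H_{\alpha,G}$; $L^{\mathrm{par}}=\{\mathcal{C}\in L\mid T^{\mathcal{C}}\in\mathrm{scc}(T)\}$. The partial characteristic polynomial is $\chi^{\mathrm{par}}_{\mathcal{A}(G)}(t)=\sum_{\mathcal{C}\in L^{\mathrm{par}}}\mu(T^{\mathcal{C}},\mathcal{C})t^{\dim\mathcal{C}}$. With $m(\mathcal{S};G)=\#\operatorname{Hom}((\Gamma/\langle\mathcal{S}\rangle)_{\operatorname{tor}},G)$, the $G$-Tutte polynomial is $T^G_{\mathcal{A}}(x,y)=\sum_{\mathcal{S}\subseteq\mathcal{A}}m(\mathcal{S};G)(x-1)^{r_{\mathcal{A}}-r_{\mathcal{S}}}(y-1)^{\#\mathcal{S}-r_{\mathcal{S}}}$ and the $G$-characteristic polynomial is $\chi^G_{\mathcal{A}}(t)=(-1)^{r_{\mathcal{A}}}t^{r_\Gamma-r_{\mathcal{A}}}T^G_{\mathcal{A}}(1-t,0)$. *)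

(* Defs.v *)
From HB Require Import structures.
From mathcomp Require Import all_boot all_order all_algebra finmap.
From mathcomp Require Import all_classical all_reals.
From mathcomp Require Import topology_theory.topology_structure
  topology_theory.connected topology_theory.product_topology
  topology_theory.function_spaces topology_theory.discrete_topology
  topology_theory.num_topology.
From mathcomp Require Import normedtype.

Set Implicit Arguments.
Unset Strict Implicit.
Unset Printing Implicit Defensive.
Import Order.TTheory GRing.Theory Num.Theory.
Import numFieldNormedType.Exports.
Local Open Scope classical_set_scope.
Local Open Scope ring_scope.

Section GammaTheory.
Context {Gamma : zmodType}.

Definition zindep (v : seq Gamma) : Prop :=
  forall c : 'I_(size v) -> int,
    \sum_(i < size v) (v`_i) *~ c i = 0 -> forall i, c i = 0.

Definition fin_gen : Prop :=
  exists s : seq Gamma, forall x : Gamma,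
    exists c : 'I_(size s) -> int, x = \sum_(i < size s) (s`_i) *~ c i.

Definition is_rank (H : set Gamma) (n : nat) : Prop :=
  (exists v : seq Gamma, [/\ size v = n, (forall x, x \in v -> H x) & zindep v])
  /\ (forall v : seq Gamma, (forall x, x \in v -> H x) -> zindep v ->
        (size v <= n)%N).

Definition zrank (H : set Gamma) : nat :=
  match pselect (exists n, is_rank H n) with
  | left e => projT1 (cid e)
  | right _ => 0%N
  end.

Definition torsion (x : Gamma) : Prop := exists n : nat, (0 < n)%N /\ x *+ n = 0.

Definition span (A : seq Gamma) (S : {set 'I_(size A)}) : set Gamma :=
  [set x | exists c : 'I_(size A) -> int, x = \sum_(i in S) (A`_i) *~ c i].

Definition rkS (A : seq Gamma) (S : {set 'I_(size A)}) : nat := zrank (span S).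
Definition rkG : nat := zrank [set: Gamma].

(* preimage in Gamma of the torsion subgroup (Gamma/<S>)_tor *)
Definition torQ (A : seq Gamma) (S : {set 'I_(size A)}) : set Gamma :=
  [set x | exists n : nat, (0 < n)%N /\ span S (x *+ n)].

End GammaTheory.

(* The group G = (S^1)^p x R^q x F with its Lie group topology.         *)
(* S^1 is realised as the unit circle in R^2 = C, group law = complex   *)
(* multiplication; R^q with addition; F a finite abelian group with the *)
(* discrete topology.  The ambient space is                             *)
(*   Gamb = (R^2)^p x R^q x F   (product topology),                     *)
(* and G is the subset Gset (unit circles in each S^1 factor) with the  *)
(* operation Gadd and neutral element Gzero.                            *)
Notation Gamb R p q F :=
  ((prod_topology (fun _ : 'I_p => (R * R)%type) *
    prod_topology (fun _ : 'I_q => (R : realType))) * discrete_topology F)%type.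

Section TheGroup.
Context {R : realType} {p q : nat} {F : finZmodType}.
Local Notation Gamb := (Gamb R p q F).

Definition cmul (a b : R * R) : R * R :=
  (a.1 * b.1 - a.2 * b.2, a.1 * b.2 + a.2 * b.1).

Definition Gset : set Gamb :=
  [set a | forall i : 'I_p, (a.1.1 i).1 ^+ 2 + (a.1.1 i).2 ^+ 2 = 1].

Definition Gadd (a b : Gamb) : Gamb :=
  ((fun i => cmul (a.1.1 i) (b.1.1 i), fun j => a.1.2 j + b.1.2 j),
   ((a.2 : F) + (b.2 : F) : F)).

Definition Gzero : Gamb := ((fun _ => (1, 0), fun _ => 0), (0 : F)).

End TheGroup.

(* The arrangement A(G) in T = Hom(Gamma, G), pointwise (= compact-open,*)
(* Gamma discrete) topology.                                             *)
Section Arrangement.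
Context {R : realType} (p q : nat) (F : finZmodType) {Gamma : zmodType}
  (A : seq Gamma).

Local Notation TT := (prod_topology (fun _ : Gamma => Gamb R p q F)).

Definition Tset : set TT :=
  [set phi | (forall x, Gset (phi x)) /\
             (forall x y, phi (x + y) = Gadd (phi x) (phi y))].

Definition Halpha (a : Gamma) : set TT := [set phi | Tset phi /\ phi a = Gzero].
Definition HS (S : {set 'I_(size A)}) : set TT :=
  [set phi | Tset phi /\ forall i, i \in S -> phi (A`_i) = Gzero].

Definition components (X : set TT) : set (set TT) :=
  [set C | exists x, X x /\ C = connected_component X x].

Definition Lposet : set (set TT) :=
  [set C | exists S : {set 'I_(size A)}, components (HS S) C].

Definition Lle (C D : set TT) : Prop := D `<=` C.

(* Moebius function of L, by the usual recursion
   mu(x,x)=1, mu(x,y) = - sum_{x <= z < y} mu(x,z) for x < y, 0 otherwise;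
   the recursion depth is bounded by the (finite) size of L. *)
Fixpoint mob_aux (n : nat) (C D : set TT) : int :=
  match n with
  | 0%N => 0
  | n'.+1 =>
      if `[< C = D >] then 1
      else if `[< Lle C D >] then
        - \sum_(E \in [set E | Lposet E /\ Lle C E /\ Lle E D /\ E <> D])
            mob_aux n' C E
      else 0
  end.

Definition mobius (C D : set TT) : int :=
  mob_aux (#|` fset_set Lposet|).+1 C D.

(* dim C = g (r_Gamma - r_S) for S such that C is a component of H_S;
   we take the maximal such S, namely S_C = {alpha in A | C <= H_alpha}. *)
Definition SC (C : set TT) : {set 'I_(size A)} :=
  [set i : 'I_(size A) | `[< C `<=` Halpha (A`_i) >]].

Definition dimC (C : set TT) : nat := ((p + q) * (@rkG Gamma - rkS (SC C)))%N.

Definition topC (C : set TT) : set TT :=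
  [set phi | exists x, C x /\ connected_component Tset x phi].

Definition scc : set (set TT) :=
  [set Ti | components Tset Ti /\
     ~ (exists i : 'I_(size A), torsion (A`_i) /\ Ti `<=` Halpha (A`_i))].

Definition Lpar : set (set TT) := [set C | Lposet C /\ scc (topC C)].

Definition chi_par : {poly int} :=
  \sum_(C \in Lpar) (mobius (topC C) C)%:P * 'X^(dimC C).

(* Hom((Gamma/<S>)_tor, G), realised as the homomorphisms from the subgroup
   torQ S (the preimage of (Gamma/<S>)_tor) to G that vanish on <S>,
   extended by Gzero outside torQ S. *)
Definition HomTorQ (S : {set 'I_(size A)}) : set (Gamma -> Gamb R p q F) :=
  [set f | (forall x, Gset (f x)) /\
     (forall x y, torQ S x -> torQ S y -> f (x + y) = Gadd (f x) (f y)) /\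
     (forall x, span S x -> f x = Gzero) /\
     (forall x, ~ torQ S x -> f x = Gzero)].

Definition mS (S : {set 'I_(size A)}) : nat := #|` fset_set (HomTorQ S)|.

Definition tutteG (Rg : comRingType) (x y : Rg) : Rg :=
  \sum_(S : {set 'I_(size A)})
    (mS S)%:R * (x - 1) ^+ (rkS [set: 'I_(size A)] - rkS S)
              * (y - 1) ^+ (#|S| - rkS S).

Definition chiG : {poly int} :=
  (-1) ^+ (rkS [set: 'I_(size A)]) *: 'X^(@rkG Gamma - rkS [set: 'I_(size A)])
    * tutteG (1 - 'X) 0.

End Arrangement.

(* Main.v *)
Require Import Defs.
From HB Require Import structures.
From mathcomp Require Import all_boot all_order all_algebra finmap.
From mathcomp Require Import all_classical all_reals.
From mathcomp Require Import topology normedtype trigo.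
From mathcomp Require Import complex ring lra zify.

(** For a component C of the arrangement put
      f(C) = sum over the sublists S such that C is a component of H_S of (-1)^#S.
    If C lies in H_S then exactly one component of H_S contains C, so summing f
    over the elements of L containing C gives the alternating sum over all
    sublists of the list of those alpha that vanish on C, which is 1 when that
    list is empty and 0 otherwise.  By Moebius inversion f(C) = mu(T^C, C) when
    T^C belongs to scc(T) and f(C) = 0 otherwise: an alpha vanishing on a whole
    component of T is torsion because g > 0.  Hence the partial characteristic
    polynomial is the sum over S of (-1)^#S t^(g(r_Gamma - r_S)) times the number
    of components of H_S.

    To count these, split Gamma = M + Z^d with M the preimage of the torsion of
    Gamma/<S> and d = r_Gamma - r_S.  A homomorphism phi in H_S takes torsion
    values on M, so phi|M is constant on components, and so is the F-part of
    phi.  Conversely two elements with the same phi|M and the same F-part are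
    joined by a path t |-> phi + exp(t l), l : Gamma -> Lie(G).  So the
    components are indexed by Hom(M/<S>, G) x F^d. *)

Set Implicit Arguments.
Unset Strict Implicit.
Unset Printing Implicit Defensive.
Import Order.TTheory GRing.Theory Num.Theory.
Import numFieldNormedType.Exports.
Local Open Scope classical_set_scope.
Local Open Scope ring_scope.

(** * Saturated subgroups split off *)

Section Subgroups.
Context {V : zmodType}.

Definition is_subgroup (M : set V) :=
  M 0 /\ (forall x y, M x -> M y -> M (x - y)).

Variable M : set V.
Hypothesis subM : is_subgroup M.

Lemma subgroupN x : M x -> M (- x).
Proof. by case: subM => M0 MB Mx; rewrite -sub0r; apply: MB. Qed.

Lemma subgroupD x y : M x -> M y -> M (x + y).
Proof.
case: (subM) => _ MB Mx My; rewrite -[y]opprK; apply: MB => //.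
exact: subgroupN.
Qed.

Lemma subgroupMz x (n : int) : M x -> M (x *~ n).
Proof.
move=> Mx; elim/int_rect: n => [|n IH|n IH]; first by rewrite mulr0z; case: subM.
  by rewrite intS mulrzDr mulr1z; apply: subgroupD.
rewrite intS opprD mulrzDr mulrNz mulr1z; apply: subgroupD => //.
exact: subgroupN.
Qed.

Lemma subgroupMn x n : M x -> M (x *+ n).
Proof. by move=> Mx; rewrite pmulrn; apply: subgroupMz. Qed.

Lemma subgroup_sum I (r : seq I) (P : pred I) (f : I -> V) :
  (forall i, P i -> M (f i)) -> M (\sum_(i <- r | P i) f i).
Proof.
by move=> Mf; apply: big_ind => //; [case: subM | apply: subgroupD].
Qed.

End Subgroups.

Section Splitting.
Context {V : zmodType}.

Definition lin_comb d (e : 'I_d -> V) (c : 'rV[int]_d) : V :=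
  \sum_i e i *~ c 0 i.

(** The rule for a change of generators: the rows of [U] give a new family, and [c *m U] converts
    coordinates in it to coordinates in [e]. *)
Lemma lin_combM m d (e : 'I_d -> V) (c : 'rV[int]_m) (U : 'M[int]_(m, d)) :
  lin_comb e (c *m U) = lin_comb (fun i => lin_comb e (row i U)) c.
Proof.
rewrite /lin_comb.
under eq_bigr => j _ do rewrite mxE mulrz_sumr.
rewrite exchange_big; apply: eq_bigr => i _ /=.
rewrite mulrz_suml; apply: eq_bigr => j _.
by rewrite !mxE mulrC mulrzA.
Qed.

Lemma lin_combB d (e : 'I_d -> V) (b c : 'rV[int]_d) :
  lin_comb e (b - c) = lin_comb e b - lin_comb e c.
Proof.
by rewrite /lin_comb -sumrB; apply: eq_bigr => i _; rewrite !mxE mulrzBr.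
Qed.

Lemma lin_comb_delta d (e : 'I_d -> V) i : lin_comb e (delta_mx 0 i) = e i.
Proof.
rewrite /lin_comb (bigD1 i) //= big1 ?addr0 => [|j /negPf ji].
  by rewrite mxE !eqxx.
by rewrite mxE ji andbF mulr0z.
Qed.

(* V = M (+) Z^d: the images of the [e i] form a basis of V/M, and [c] reads
   coordinates in that basis. *)
Definition splits (M : set V) d (e : 'I_d -> V) (c : {additive V -> 'rV[int]_d}) :=
  [/\ forall x, M (x - lin_comb e (c x)), forall x, M x <-> c x = 0 &
      forall i, c (e i) = delta_mx 0 i].

(** For a subgroup M this says that V/M is torsion-free. *)
Definition saturated (M : set V) := forall n x, (0 < n)%N -> M (x *+ n) -> M x.

(* A nonzero relation between generators modulo M becomes, after a unimodular
   change of generators (Smith form of a row), k e'_0 in M with k != 0; as M is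
   saturated, e'_0 is in M and can be dropped. *)
Lemma splits_of_generators (M : set V) d (e : 'I_d -> V) :
  is_subgroup M -> saturated M ->
  (forall x, exists c, M (x - lin_comb e c)) ->
  exists d' e' c', @splits M d' e' c'.
Proof.
move=> subM satM; elim: d e => [|d IH] e gen_e.
  (* Without generators [gen_e] forces V = M, and the zero map serves. *)
  pose c : V -> 'rV[int]_0 := fun=> 0.
  have cB : zmod_morphism c by move=> x y; rewrite subr0.
  pose C : {additive V -> 'rV[int]_0} := HB.pack c (GRing.isZmodMorphism.Build _ _ c cB).
  exists 0%N, e, C; split=> [x|x|[]] //=.
    by have [b] := gen_e x; rewrite thinmx0 (thinmx0 (C x)).
  split=> // _; have [b] := gen_e x.
  by rewrite /lin_comb big_ord0 subr0.
have [[b [bN0 Mb]]|freeM] :=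
  pselect (exists b : 'rV[int]_d.+1, b != 0 /\ M (lin_comb e b)).
  have [L _ [U Uu [D _ bE]]] := int_Smith_normal_form b.
  pose e' i := lin_comb e (row i U).
  have e'E c : lin_comb e (c *m U) = lin_comb e' c by rewrite lin_combM.
  have Me0 : M (e' 0).
    have bE' : b = (L 0 0 * D`_0) *: delta_mx 0 0 *m U.
      rewrite [LHS]bE; congr (_ *m U); apply/rowP => j.
      rewrite !mxE big_ord1 !mxE eqxx /=; case: j => -[|j] jlt //=.
        by rewrite mulr1.
      by rewrite mulr0n !mulr0.
    have k0 : L 0 0 * D`_0 != 0.
      by apply: contra_neq bN0 => k0; rewrite bE' k0 scale0r mul0mx.
    move: Mb; rewrite bE' e'E; move: (L 0 0 * D`_0) k0 => k k0.
    have -> : lin_comb e' (k *: delta_mx 0 0) = e' 0 *~ k.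
      rewrite -(lin_comb_delta e' 0) /lin_comb mulrz_suml; apply: eq_bigr => i _.
      by rewrite !mxE [k * _]mulrC mulrzA.
    (* Saturation is phrased with natural multiples, so k is replaced by its absolute value. *)
    move=> Mk; have kgt0 : (0 < `|k|)%N by rewrite absz_gt0.
    apply: (satM _ _ kgt0).
    rewrite pmulrn abszE; have [k_ge0|/ltW k_le0] := leP 0 k.
      by rewrite ger0_norm.
    by rewrite ler0_norm // mulrNz; apply: subgroupN.
  apply: (IH (fun i => e' (lift 0 i))) => x.
  have [a Ma] := gen_e x.
  pose a' := a *m invmx U.
  have aE : a = a' *m U by rewrite /a' mulmxKV.
  exists (\row_i a' 0 (lift 0 i)).
  move: Ma; rewrite aE e'E {1}/lin_comb big_ord_recl opprD addrCA => Ma.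
  have := subgroupD subM Ma (subgroupMz subM (a' 0 0) Me0).
  rewrite addrAC addNr add0r /lin_comb.
  by under [in X in _ -> X]eq_bigr => i _ do rewrite mxE.
(* With no nonzero relation modulo M, coordinates are unique; uniqueness makes the chosen [c]
   additive. *)
have uniqM a b : M (lin_comb e a - lin_comb e b) -> a = b.
  move=> Mab; apply/eqP; rewrite -subr_eq0; apply/negP => /negP abN0.
  by apply: freeM; exists (a - b); rewrite lin_combB.
have [c Mc] := choice gen_e.
have cuniq x a : M (x - lin_comb e a) -> c x = a.
  move=> Ma; apply: uniqM; have [_ MB] := subM.
  by have := MB _ _ Ma (Mc x); rewrite opprB addrC addrA subrK.
have cB : zmod_morphism c.
  move=> x y; apply: cuniq; have [_ MB] := subM.
  by rewrite lin_combB opprD addrACA -opprD; apply: MB.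
pose C : {additive V -> 'rV[int]_d.+1} := HB.pack c (GRing.isZmodMorphism.Build _ _ c cB).
exists d.+1, e, C; split=> //.
- move=> x; split=> [Mx|/= c0]; last first.
    have := Mc x; rewrite c0 /lin_comb big1 ?subr0 // => i _.
    by rewrite mxE mulr0z.
  apply: cuniq; rewrite /lin_comb big1 ?subr0 // => i _.
  by rewrite mxE mulr0z.
- by move=> i; apply: cuniq; rewrite lin_comb_delta subrr; case: subM.
Qed.

Lemma fin_gen_splits (M : set V) : fin_gen (Gamma := V) ->
  is_subgroup M -> saturated M -> exists d e c, @splits M d e c.
Proof.
move=> [s gen_s] subM satM.
apply: (@splits_of_generators M (size s) (fun i => s`_i)) => // x.
have [c ->] := gen_s x; exists (\row_i c i); rewrite /lin_comb.
under [X in _ - X]eq_bigr => i _ do rewrite mxE.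
by rewrite subrr; case: subM.
Qed.

End Splitting.

(** * Ranks over the rationals *)

Section Saturation.
Context {V : zmodType}.

(** The preimage of the torsion of V/N. [torQ S] is the case of the span of S, and N = 0 gives the
    torsion subgroup. *)
Definition saturation (N : set V) : set V :=
  [set x | exists n : nat, (0 < n)%N /\ N (x *+ n)].

Lemma saturation_subgroup N : is_subgroup N -> is_subgroup (saturation N).
Proof.
move=> subN; split; first by exists 1%N; rewrite mul0rn; case: subN.
move=> x y [m [m0 Nx]] [n [n0 Ny]]; exists (m * n)%N; rewrite muln_gt0 m0 n0.
split=> //; rewrite mulrnBl mulrnA [(m * n)%N]mulnC mulrnA.
by have [_] := subN; apply; apply: subgroupMn.
Qed.

Lemma saturation_saturated N : saturated (saturation N).
Proof.
move=> n x n0 [m [m0 Nx]]; exists (n * m)%N.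
by rewrite muln_gt0 n0 m0 mulrnA.
Qed.

Lemma sub_saturation N : N `<=` saturation N.
Proof. by move=> x Nx; exists 1%N; rewrite mulr1n. Qed.

Lemma subgroup0 : is_subgroup [set 0 : V].
Proof. by split=> // x y /= -> ->; rewrite subr0. Qed.

Lemma span_subgroup (A : seq V) (S : {set 'I_(size A)}) : is_subgroup (Defs.span S).
Proof.
split; first by exists (fun=> 0); rewrite big1 // => i _; rewrite mulr0z.
move=> x y [b ->] [c ->]; exists (fun i => b i - c i).
by rewrite -sumrB; apply: eq_bigr => i _; rewrite mulrzBr.
Qed.

Lemma span_gen (A : seq V) (S : {set 'I_(size A)}) i : i \in S -> Defs.span S A`_i.
Proof.
move=> iS; exists (fun j => (j == i)%:R).
rewrite (bigD1 i) //= big1 ?addr0 ?eqxx ?mulr1z // => j /andP[_ /negPf ->].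
by rewrite mulr0z.
Qed.

Lemma torQ_subgroup (A : seq V) (S : {set 'I_(size A)}) : is_subgroup (torQ S).
Proof. exact/saturation_subgroup/span_subgroup. Qed.

Lemma torQ_saturated (A : seq V) (S : {set 'I_(size A)}) : saturated (torQ S).
Proof. exact: saturation_saturated. Qed.

Lemma span_torQ (A : seq V) (S : {set 'I_(size A)}) : Defs.span S `<=` torQ S.
Proof. exact: sub_saturation. Qed.

Lemma torsion_torQ (A : seq V) (S : {set 'I_(size A)}) x : torsion x -> torQ S x.
Proof.
move=> [n [n0 xn0]]; exists n; split=> //; rewrite xn0.
by case: (span_subgroup S).
Qed.

End Saturation.

Lemma clear_denominators k (u : 'rV[rat]_k) :
  exists n (w : 'rV[int]_k), n != 0 :> int /\ map_mx intr w = n%:~R *: u.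
Proof.
pose n := \prod_i denq (u 0 i).
exists n, (\row_i (numq (u 0 i) * \prod_(j | j != i) denq (u 0 j))); split.
  by apply/prodf_neq0 => i _; rewrite denq_neq0.
apply/rowP => i; rewrite !mxE /n [in RHS](bigD1 i) //=.
rewrite !rmorphM /= numqE.
by rewrite -[LHS]mulrA [LHS]mulrC.
Qed.

Section Rank.
Context {V : zmodType} (r : nat) (e0 : 'I_r -> V)
  (c0 : {additive V -> 'rV[int]_r}).
Hypothesis splits0 : splits (saturation [set 0]) e0 c0.

(** The image of x in V tensored with Q, identified with Q^r by a basis of V modulo torsion. *)
Definition ratvec (x : V) : 'rV[rat]_r := map_mx intr (c0 x).

Lemma ratvec_sum I (s : seq I) (P : pred I) (f : I -> V) (a : I -> int) :
  ratvec (\sum_(i <- s | P i) f i *~ a i) =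
  \sum_(i <- s | P i) (a i)%:~R *: ratvec (f i).
Proof.
rewrite /ratvec !raddf_sum; apply: eq_bigr => i _ /=.
by rewrite !raddfMz -scaler_int.
Qed.

Lemma ratvecMn x n : ratvec (x *+ n) = n%:R *: ratvec x.
Proof. by rewrite /ratvec !raddfMn scaler_nat. Qed.

Lemma ratvecD x y : ratvec (x + y) = ratvec x + ratvec y.
Proof. by rewrite /ratvec !raddfD. Qed.

Lemma ratvec_eq0 x : ratvec x = 0 -> torsion x.
Proof.
move=> x0; have [_ k0 _] := splits0; apply: (proj2 (k0 x)).
apply/rowP => i; move/rowP: x0 => /(_ i).
by rewrite !mxE => /eqP; rewrite intr_eq0 => /eqP.
Qed.

(** An integral relation is a rational one. Conversely, clearing denominators in a rational relation
    gives a combination that is only torsion; a further multiple [m] makes it a true relation in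
    V. *)
Lemma zindep_row_free n (v : seq V) : size v = n ->
  zindep v <-> row_free (\matrix_(i < n) ratvec v`_i).
Proof.
move=> <-; set B := \matrix_i _.
have mulB (w : 'rV[int]_(size v)) :
    map_mx intr w *m B = ratvec (\sum_(i < size v) v`_i *~ w 0 i).
  rewrite ratvec_sum mulmx_sum_row; apply: eq_bigr => i _.
  by rewrite rowK mxE.
split=> [indep_v|freeB c vc0 i]; last first.
  have := mulB (\row_i c i); under eq_bigr do rewrite mxE.
  rewrite vc0 [ratvec 0]/ratvec !raddf0 => /eqP.
  rewrite mulmx_free_eq0 // => /eqP/rowP/(_ i).
  by rewrite !mxE => /eqP; rewrite intr_eq0 => /eqP.
apply: inj_row_free => u uB0.
have [k [w [k0 wE]]] := clear_denominators u.
have /ratvec_eq0[m [m0 wm0]] : ratvec (\sum_(i < size v) v`_i *~ w 0 i) = 0.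
  by rewrite -mulB wE -scalemxAl uB0 scaler0.
have w0 : w = 0.
  apply/rowP => i; rewrite mxE.
  have : w 0 i * m%:Z = 0.
    apply: (indep_v (fun i => w 0 i * m%:Z)).
    rewrite -[RHS]wm0 pmulrn mulrz_suml; apply: eq_bigr => j _.
    by rewrite mulrzA.
  by move/eqP; rewrite mulf_eq0 [m%:Z == 0]gtn_eqF // orbF => /eqP.
move: wE; rewrite w0 map_mx0 => /esym/eqP.
by rewrite scaler_eq0 intr_eq0 (negPf k0) => /eqP.
Qed.

(** A maximal free set of rows of the matrix gives an independent family in N, and no family in N
    can exceed the row space. Since [zrank] is picked by choice, the end of the proof checks that
    two numbers satisfying [is_rank] bound each other. *)
Lemma zrank_ratvec (N : set V) k (b : 'I_k -> V) : (forall i, N (b i)) ->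
  (forall x, N x -> (ratvec x <= \matrix_i ratvec (b i))%MS) ->
  zrank N = \rank (\matrix_i ratvec (b i)).
Proof.
move=> Nb genb; set B := \matrix_i _.
have rankB : is_rank N (\rank B).
  split=> [|v Nv /(zindep_row_free erefl)/eqP <-]; last first.
    apply: mxrankS; apply/row_subP => i; rewrite rowK; apply: genb.
    exact/Nv/mem_nth.
  pose f := maxrankfun B; pose v := [seq b (f i) | i <- enum 'I_(\rank B)].
  have sv : size v = \rank B by rewrite size_map size_enum_ord.
  exists v; split=> //; first by move=> x /mapP[i _ ->].
  apply/(zindep_row_free sv).
  rewrite [X in row_free X](_ : _ = rowsub f B) ?maxrowsub_free //.
  apply/row_matrixP => i; rewrite rowK row_rowsub rowK.
  by rewrite (nth_map i) ?size_enum_ord // nth_ord_enum.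
rewrite /zrank; case: pselect => [ex|[]]; last by exists (\rank B).
case: cid => n /= [[v [sv Nv iv]] maxn].
case: rankB => [[w [sw Nw iw]] maxB]; apply/eqP; rewrite eqn_leq.
by rewrite -{1}sv -{2}sw maxB //= maxn.
Qed.

Lemma rkG_splits : @rkG V = r.
Proof.
have e0E : \matrix_i ratvec (e0 i) = 1%:M.
  apply/row_matrixP => i; rewrite rowK rowE mulmx1 /ratvec.
  by have [_ _ ->] := splits0; rewrite map_delta_mx.
have := @zrank_ratvec [set: V] _ e0 (fun=> I); rewrite e0E mxrank1; apply => x _.
exact: submx1.
Qed.

Variable A : seq V.
Implicit Types S : {set 'I_(size A)}.

Definition ratmx S : 'M[rat]_(#|S|, r) := \matrix_j ratvec A`_(enum_val j : 'I_(size A)).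

(** Over Q the factor n can be divided out, so passing from the span to its saturation adds nothing
    to the row space. *)
Lemma ratvec_torQ S x : torQ S x -> (ratvec x <= ratmx S)%MS.
Proof.
move=> [n [n0 [c xE]]]; have : (ratvec (x *+ n) <= ratmx S)%MS.
  rewrite xE ratvec_sum; apply: summx_sub => i iS; apply: scalemx_sub.
  have := row_sub (enum_rank_in iS i) (ratmx S).
  by rewrite rowK enum_rankK_in.
by rewrite ratvecMn (eqmx_scale _ _) // pnatr_eq0 -lt0n.
Qed.

Lemma rkSE S : rkS S = \rank (ratmx S).
Proof.
apply: (@zrank_ratvec _ _ (fun j : 'I_#|S| => A`_(enum_val j : 'I_(size A)))) => [j|x Sx].
  exact/span_gen/enum_valP.
exact/ratvec_torQ/span_torQ.
Qed.

Lemma rkS_le_card S : (rkS S <= #|S|)%N.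
Proof. by rewrite rkSE rank_leq_row. Qed.

Lemma rkS_torQ S S' : (forall i, i \in S -> torQ S' A`_i) -> (rkS S <= rkS S')%N.
Proof.
move=> SS'; rewrite !rkSE; apply/mxrankS/row_subP => j; rewrite rowK.
exact/ratvec_torQ/SS'/enum_valP.
Qed.

(** Additivity of rank along V/[torQ S]. The rows of S together with the images of [e] span Q^r,
    which gives one inequality; a matrix of rank at least d that kills the rows of S gives the
    other. *)
Lemma rkG_torQ S d (e : 'I_d -> V) (c : {additive V -> 'rV[int]_d}) :
  splits (torQ S) e c -> @rkG V = (rkS S + d)%N.
Proof.
move=> [Se Sc0 Sce]; rewrite rkG_splits rkSE; apply/eqP; rewrite eqn_leq.
have [e0E c00 c0e] := splits0; apply/andP; split.
  pose E := \matrix_i ratvec (e i).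
  have le_rank : (\rank (ratmx S + E)%MS <= \rank (ratmx S) + d)%N.
    rewrite (leq_trans (mxrank_adds_leqif _ _)) // leq_add2l rank_leq_row //.
  apply: leq_trans le_rank; rewrite -[X in (X <= _)%N](mxrank1 rat).
  apply/mxrankS/row_subP => i; rewrite rowE mulmx1.
  have -> : delta_mx 0 i = ratvec (e0 i).
    by rewrite /ratvec c0e map_delta_mx.
  rewrite -[e0 i](subrK (lin_comb e (c (e0 i)))) ratvecD; apply: addmx_sub_adds.
    exact: ratvec_torQ.
  rewrite /lin_comb ratvec_sum; apply: summx_sub => j _; apply: scalemx_sub.
  by have := row_sub j E; rewrite rowK.
(* P expresses c through c0, so that it kills the rows coming from S. *)
pose P := \matrix_i map_mx intr (c (e0 i)) : 'M[rat]_(r, d).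
have cP x : map_mx intr (c x) = ratvec x *m P.
  have /torsion_torQ-/(_ _ S)/Sc0 : torsion (x - lin_comb e0 (c0 x)) by apply: e0E.
  rewrite raddfB => /eqP; rewrite subr_eq0 => /eqP ->.
  rewrite mulmx_sum_row /lin_comb !raddf_sum; apply: eq_bigr => i _ /=.
  by rewrite !raddfMz rowK mxE scaler_int.
have SP0 : ratmx S *m P = 0.
  apply/row_matrixP => j; rewrite row_mul rowK -cP row0.
  have /Sc0 -> : torQ S A`_(enum_val j : 'I_(size A)).
    exact/span_torQ/span_gen/enum_valP.
  by rewrite map_mx0.
apply: leq_trans (mulmx0_rank_max SP0); rewrite leq_add2l.
rewrite -[X in (X <= _)%N](mxrank1 rat).
rewrite [X in (\rank X <= _)%N](_ : _ = \matrix_i ratvec (e i) *m P) ?mxrankM_maxr //.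
apply/row_matrixP => i; rewrite row_mul rowK -cP Sce map_delta_mx rowE.
by rewrite mulmx1.
Qed.

End Rank.

(** * The group G *)

Section Topology.

(** In a Hausdorff space finite sets are closed, so a point of a finite set C is both open and
    closed in C. *)
Lemma finite_connected_eq (T : topologicalType) (C : set T) : hausdorff_space T ->
  connected C -> finite_set C -> forall x y, C x -> C y -> x = y.
Proof.
move=> hT conC finC x y Cx Cy.
have /accessible_finite_set_closed clT := hausdorff_accessible hT.
suff CE : [set x] = C by move: Cy; rewrite -CE => ->.
apply: conC; first by exists x.
  exists (~` (C `\ x)).
    apply: closed_openC; apply: clT; apply: sub_finite_set finC; exact: subDsetl.
  apply/seteqP; split=> [_ ->|z [Cz] nCz]; first by split=> // -[] _; apply.
  by apply: contrapT => zx; apply: nCz; split.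
exists [set x]; first by apply: clT; exact: finite_set1.
by apply/seteqP; split=> [_ ->|z []].
Qed.

Lemma prod_topology_continuous (X : topologicalType) (I : eqType)
    (K : I -> topologicalType) (f : X -> prod_topology K) :
  (forall i, continuous (fun x => f x i)) -> continuous f.
Proof.
move=> cf x; apply/cvg_sup => i.
move: x; apply: continuous_comp_initial; exact: cf.
Qed.

Lemma pair_continuous (X Y Z : topologicalType) (f : X -> Y) (g : X -> Z) :
  continuous f -> continuous g -> continuous (fun x => (f x, g x)).
Proof. by move=> cf cg x; apply: cvg_pair; [apply: cf | apply: cg]. Qed.

End Topology.

(** * The unit circle: arguments and roots of unity *)

Section Circle.
Context {R : realType}.
Implicit Types (a b c : R * R) (s t : R).

Definition on_circle a := a.1 ^+ 2 + a.2 ^+ 2 = 1.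
Definition cis t : R * R := (cos t, sin t).
Definition cconj a : R * R := (a.1, - a.2).

Lemma cmulC a b : cmul a b = cmul b a.
Proof. by rewrite /cmul; congr (_, _); ring. Qed.

Lemma cmulA a b c : cmul a (cmul b c) = cmul (cmul a b) c.
Proof. by rewrite /cmul /=; congr (_, _); ring. Qed.

Lemma cmul1 a : cmul a (1, 0) = a.
Proof. by case: a => x y; rewrite /cmul /=; congr (_, _); ring. Qed.

Lemma cmulV a : on_circle a -> cmul a (cconj a) = (1, 0).
Proof. by move=> <-; rewrite /cmul /=; congr (_, _); ring. Qed.

Lemma on_circleM a b : on_circle a -> on_circle b -> on_circle (cmul a b).
Proof.
rewrite /on_circle => a1 b1; rewrite -[RHS]mulr1 -{1}a1 -b1 /cmul /=; ring.
Qed.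

Lemma on_circle_conj a : on_circle a -> on_circle (cconj a).
Proof. by rewrite /on_circle /= sqrrN. Qed.

Lemma on_circle_cis t : on_circle (cis t).
Proof. exact: cos2Dsin2. Qed.

Lemma cisD s t : cis (s + t) = cmul (cis s) (cis t).
Proof. by rewrite /cis cosD sinD /cmul /=; congr (_, _); ring. Qed.

Lemma cis0 : cis 0 = (1, 0).
Proof. by rewrite /cis cos0 sin0. Qed.

Lemma on_circle_arg a : on_circle a -> exists t, a = cis t.
Proof.
case: a => x y; rewrite /on_circle /= => xy1.
have x1 : -1 <= x <= 1.
  (* The arccosine gives an angle in the upper half circle; the sign of y decides whether to negate
     it. *)
  by apply/andP; split; nra.
have [sgn|sgn] := leP 0 y; [exists (acos x) | exists (- acos x)].
  rewrite /cis acosK ?sin_acos // -xy1 addrAC subrr add0r sqrtr_sqr.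
  by rewrite ger0_norm.
rewrite /cis cosN sinN acosK ?sin_acos // -xy1 addrAC subrr add0r sqrtr_sqr.
by rewrite ltr0_norm // opprK.
Qed.

Definition cpow a n : R * R := iter n (cmul a) (1, 0).

(** Viewed in the algebraically closed field [R[i]], such points are roots of the nonzero polynomial
    X^n - 1. *)
Lemma finite_unity_roots n : (0 < n)%N ->
  exists s : seq (R * R), forall a, cpow a n = (1, 0) -> a \in s.
Proof.
move=> n0; pose toC a : R[i] := Complex a.1 a.2.
have toCM a b : toC (cmul a b) = toC a * toC b by case: a b => x y [z t].
have toCX a m : toC (cpow a m) = toC a ^+ m.
  by elim: m => [|m IH] //; rewrite exprS -IH -toCM.
pose P : {poly R[i]} := 'X^n - 1.
have [s PE] := closed_field_poly_normal P.
have P0 : P != 0 by rewrite -size_poly_eq0 size_XnsubC.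
exists [seq (complex.Re z, complex.Im z) | z <- s] => a an1.
have : root P (toC a).
  by rewrite /root /P !hornerE -toCX an1 subr_eq0.
rewrite PE rootZ ?lead_coef_eq0 // root_prod_XsubC => az.
by apply/mapP; exists (toC a) => //; case: a {an1 az}.
Qed.

End Circle.

(** * Group laws and the exponential map of G *)

Section LieGroup.
Context {R : realType} {p q : nat} {F : finZmodType}.
Implicit Types (a b c : Gamb R p q F).

Local Notation Gzero := (@Gzero R p q F).

(** The conjugate inverts a circle coordinate only on the unit circle, so this is an inverse on
    [Gset] and not on the whole ambient space. *)
Definition Gopp a : Gamb R p q F :=
  ((fun i => cconj (a.1.1 i), fun j => - a.1.2 j), - (a.2 : F)).

(** The exponential map of the Lie algebra R^p x R^q, followed by translation to the component of G
    indexed by [w]. *)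
Definition Gexp (s : 'I_p -> R) (v : 'I_q -> R) (w : F) : Gamb R p q F :=
  ((fun i => cis (s i), v), w).

Lemma Gamb_eq a b : (forall i, a.1.1 i = b.1.1 i) ->
  (forall j, a.1.2 j = b.1.2 j) -> a.2 = b.2 -> a = b.
Proof.
case: a b => [[a1 a2] a3] [[b1 b2] b3] /= /funext-> /funext-> ->.
by [].
Qed.

Lemma GaddC a b : Gadd a b = Gadd b a.
Proof.
by apply: Gamb_eq => [i|j|] /=; [apply: cmulC | apply: addrC | apply: addrC].
Qed.

Lemma GaddA a b c : Gadd a (Gadd b c) = Gadd (Gadd a b) c.
Proof.
by apply: Gamb_eq => [i|j|] /=; [apply: cmulA | apply: addrA | apply: addrA].
Qed.

Lemma Gadd0 a : Gadd a Gzero = a.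
Proof.
by apply: Gamb_eq => [i|j|] /=; [apply: cmul1 | apply: addr0 | apply: addr0].
Qed.

Lemma GaddV a : Gset a -> Gadd a (Gopp a) = Gzero.
Proof.
by move=> Ga; apply: Gamb_eq => [i|j|] /=; [apply/cmulV/Ga | apply: subrr | apply: subrr].
Qed.

Lemma GaddACA a b c d : Gadd (Gadd a b) (Gadd c d) = Gadd (Gadd a c) (Gadd b d).
Proof. by rewrite -!GaddA; congr Gadd; rewrite !GaddA [Gadd b c]GaddC. Qed.

Lemma Gset0 : Gset Gzero.
Proof. by move=> i /=; rewrite expr1n expr0n addr0. Qed.

Lemma Gset_add a b : Gset a -> Gset b -> Gset (Gadd a b).
Proof. by move=> Ga Gb i; apply: on_circleM. Qed.

Lemma Gset_opp a : Gset a -> Gset (Gopp a).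
Proof. by move=> Ga i; apply: on_circle_conj. Qed.

Lemma Gset_exp s v w : Gset (Gexp s v w).
Proof. by move=> i; apply: on_circle_cis. Qed.

Lemma Gadd_idem a : Gset a -> Gadd a a = a -> a = Gzero.
Proof.
by move=> Ga aa; rewrite -(GaddV Ga) -{2}aa -GaddA (GaddV Ga) Gadd0.
Qed.

Lemma Gadd_eq0 a b : Gset a -> Gadd a b = Gzero -> b = Gopp a.
Proof.
by move=> Ga ab; rewrite -[RHS]Gadd0 -ab GaddA [Gadd (Gopp a) a]GaddC GaddV // GaddC Gadd0.
Qed.

Lemma Gexp_onto a : Gset a -> exists s v, a = Gexp s v a.2.
Proof.
move=> Ga; have [s sE] := choice (fun i => on_circle_arg (Ga i)).
by exists s, a.1.2; apply: Gamb_eq.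
Qed.

End LieGroup.

(** * Homomorphisms from Gamma to G *)

Section Homs.
Context {R : realType} {p q : nat} {F : finZmodType} {V : zmodType}.
Local Notation TT := (prod_topology (fun _ : V => Gamb R p q F)).
Local Notation Gzero := (@Gzero R p q F).
Local Notation Tset := (@Tset R p q F V).
Implicit Types (phi psi : TT).

Lemma Tset0 phi : Tset phi -> phi 0 = Gzero.
Proof. by case=> Gphi Dphi; apply: Gadd_idem; rewrite // -Dphi addr0. Qed.

Lemma TsetN phi x : Tset phi -> phi (- x) = Gopp (phi x).
Proof.
move=> Tphi; have [Gphi Dphi] := Tphi; apply: Gadd_eq0 => //.
by rewrite -Dphi subrr Tset0.
Qed.

(** Used to deduce equality of homomorphisms from equality on generators; with [psi] trivial it says
    that kernels are subgroups. *)
Lemma Tset_eq_subgroup phi psi : Tset phi -> Tset psi ->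
  is_subgroup [set x | phi x = psi x].
Proof.
move=> Tphi Tpsi; split=> [|x y /= xE yE]; first by rewrite /= !Tset0.
rewrite (proj2 Tphi) (proj2 Tpsi).
by rewrite [phi (- y)]TsetN // [psi (- y)]TsetN // xE yE.
Qed.

Lemma Tset_trivial : Tset (fun=> Gzero : Gamb R p q F).
Proof. by split=> [x|x y]; [apply: Gset0 | rewrite Gadd0]. Qed.

Lemma Tset_add phi psi : Tset phi -> Tset psi ->
  Tset ((fun x => Gadd (phi x) (psi x)) : TT).
Proof.
move=> [Gphi Dphi] [Gpsi Dpsi]; split=> [x|x y]; first exact: Gset_add.
by rewrite Dphi Dpsi GaddACA.
Qed.

Lemma Tset_exp (s : 'I_p -> V -> R) (v : 'I_q -> V -> R) (w : V -> F) :
  (forall i, {morph s i : x y / x + y}) -> (forall j, {morph v j : x y / x + y}) ->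
  {morph w : x y / x + y} ->
  Tset ((fun x => Gexp (s^~ x) (v^~ x) (w x)) : TT).
Proof.
move=> sD vD wD; split=> [x|x y]; first exact: Gset_exp.
apply: Gamb_eq => [i|j|] /=; [|exact: vD|exact: wD].
by rewrite sD cisD.
Qed.

Context {A : seq V}.
Implicit Types S : {set 'I_(size A)}.
Local Notation HS S := (@HS R p q F V A S).

Lemma HS_span S phi x : HS S phi -> Defs.span S x -> phi x = Gzero.
Proof.
move=> [Tphi phiS] [c ->].
have subK := Tset_eq_subgroup Tphi Tset_trivial.
apply: (subgroup_sum subK) => i iS; apply: (subgroupMz subK).
exact: phiS.
Qed.

(** Here n phi(x) = phi(n x) = 0, and R has no torsion, so only the circle and F coordinates can be
    nontrivial. *)
Lemma HS_torsion S phi x n : HS S phi -> (0 < n)%N -> Defs.span S (x *+ n) ->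
  (forall i, cpow ((phi x).1.1 i) n = (1, 0)) /\ (forall j, (phi x).1.2 j = 0).
Proof.
move=> HSphi n0 Sxn; have [Tphi _] := HSphi.
have phiX m : phi (x *+ m) =
    (((fun i => cpow ((phi x).1.1 i) m), (fun j => (phi x).1.2 j *+ m)),
     ((phi x).2 : F) *+ m).
  elim: m => [|m IH]; first by rewrite mulr0n Tset0 //; apply: Gamb_eq.
  rewrite mulrS (proj2 Tphi) IH; apply: Gamb_eq => //= [j|].
    by rewrite -mulrS.
  by rewrite -mulrS.
have := phiX n; rewrite (HS_span HSphi Sxn) => -[/funeqP c1 /funeqP c2 _].
split=> // j; have /esym/eqP := c2 j.
by rewrite mulrn_eq0 gtn_eqF // => /eqP.
Qed.

End Homs.

(** * Connected components of H_S *)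

Section Components.
Context {R : realType} {p q : nat} {F : finZmodType} {V : zmodType}.
Local Notation TT := (prod_topology (fun _ : V => Gamb R p q F)).
Local Notation Gzero := (@Gzero R p q F).
Local Notation Tset := (@Tset R p q F V).
Context {A : seq V}.
Implicit Types S : {set 'I_(size A)}.
Implicit Types (phi psi : TT).
Local Notation HS S := (@HS R p q F V A S).

Lemma eval_continuous x : continuous ((fun phi => phi x) : TT -> Gamb R p q F).
Proof. exact: proj_continuous. Qed.

Lemma circle_coord_continuous x i :
  continuous ((fun phi => (phi x).1.1 i) : TT -> (R * R)%type).
Proof.
move=> phi; apply: (@continuous_comp _ _ _ (fun phi : TT => phi x)
  (fun a : Gamb R p q F => a.1.1 i)); first exact: eval_continuous.
apply: (@continuous_comp _ _ _ (fun a : Gamb R p q F => a.1.1)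
  (fun u : prod_topology (fun _ : 'I_p => (R * R)%type) => u i));
  last exact: proj_continuous.
apply: (@continuous_comp _ _ _ (fun a : Gamb R p q F => a.1) fst); exact: cvg_fst.
Qed.

Lemma re_coord_continuous x i :
  continuous ((fun phi => ((phi x).1.1 i).1) : TT -> R).
Proof.
move=> phi; apply: (@continuous_comp _ _ _ (fun phi : TT => (phi x).1.1 i) fst).
  exact: circle_coord_continuous.
exact: cvg_fst.
Qed.

Lemma im_coord_continuous x i :
  continuous ((fun phi => ((phi x).1.1 i).2) : TT -> R).
Proof.
move=> phi; apply: (@continuous_comp _ _ _ (fun phi : TT => (phi x).1.1 i) snd).
  exact: circle_coord_continuous.
exact: cvg_snd.
Qed.

Lemma discrete_coord_continuous x :
  continuous ((fun phi => (phi x).2) : TT -> discrete_topology F).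
Proof.
move=> phi; apply: (@continuous_comp _ _ _ (fun phi : TT => phi x) snd).
  exact: eval_continuous.
exact: cvg_snd.
Qed.

Lemma component_const (X : set TT) (Y : topologicalType) (h : TT -> Y) phi psi :
  hausdorff_space Y -> continuous h -> finite_set (h @` X) ->
  connected_component X phi psi -> h phi = h psi.
Proof.
move=> hY ch finX [C [Cphi CX conC] Cpsi].
apply: (@finite_connected_eq _ (h @` C) hY).
- by apply: connected_continuous_connected => //; apply: continuous_subspaceT.
- by apply: sub_finite_set finX; apply: image_subset.
- by exists phi.
- by exists psi.
Qed.

(** Each relevant coordinate takes finitely many values on H_S, hence is constant on components: F
    is finite, and on x in [torQ S] the circle coordinates are n-th roots of unity, with n depending
    on x only, while the real ones vanish. *)
Lemma component_HS_invariant S phi psi : connected_component (HS S) phi psi ->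
  (forall x, torQ S x -> phi x = psi x) /\ (forall x, (phi x).2 = (psi x).2).
Proof.
move=> conn.
have [HSphi HSpsi] : HS S phi /\ HS S psi.
  by case: conn => C [Cphi CH _] Cpsi; split; apply: CH.
have disc x : (phi x).2 = (psi x).2.
  apply: (@component_const (HS S) _ (fun chi => (chi x).2 : discrete_topology F)) conn.
  - exact: discrete_hausdorff.
  - exact: discrete_coord_continuous.
  - exact: finite_finset.
split=> // x [n [n0 Sxn]].
have [s sP] := @finite_unity_roots R n n0.
have HSs i : (fun chi : TT => (chi x).1.1 i) @` HS S `<=` [set` s].
  move=> _ [chi HSchi <-]; apply: sP.
  by have [] := HS_torsion HSchi n0 Sxn.
have finS i (f : R * R -> R) : finite_set ((fun chi : TT => f ((chi x).1.1 i)) @` HS S).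
  rewrite -(image_comp (fun chi : TT => (chi x).1.1 i) f); apply: finite_image.
  exact: sub_finite_set (HSs i) (finite_seq s).
have re i : ((phi x).1.1 i).1 = ((psi x).1.1 i).1.
  apply: (@component_const (HS S) R (fun chi => ((chi x).1.1 i).1)) conn => //.
  exact: re_coord_continuous.
have im i : ((phi x).1.1 i).2 = ((psi x).1.1 i).2.
  apply: (@component_const (HS S) R (fun chi => ((chi x).1.1 i).2)) conn => //.
  exact: im_coord_continuous.
apply: Gamb_eq => [i|j|//].
  by move: (re i) (im i); case: (_ i) => a b; case: (_ i) => c d /= -> ->.
have [_ ->] := HS_torsion HSphi n0 Sxn.
by have [_ ->] := HS_torsion HSpsi n0 Sxn.
Qed.

Lemma Gadd_exp_continuous (X : topologicalType) (a : Gamb R p q F)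
    (s : 'I_p -> X -> R) (v : 'I_q -> X -> R) :
  (forall i, continuous (s i)) -> (forall j, continuous (v j)) ->
  continuous ((fun t => Gadd a (Gexp (s^~ t) (v^~ t) 0)) : X -> Gamb R p q F).
Proof.
move=> cs cv.
have c1 : continuous ((fun t i => cmul (a.1.1 i) (cis (s i t))) :
    X -> prod_topology (fun _ : 'I_p => (R * R)%type)).
  apply: prod_topology_continuous => i.
  have ccos : continuous (fun t => cos (s i t)).
    move=> t; apply: (@continuous_comp _ _ _ (s i) cos); first exact: cs.
    exact: continuous_cos.
  have csin : continuous (fun t => sin (s i t)).
    move=> t; apply: (@continuous_comp _ _ _ (s i) sin); first exact: cs.
    exact: continuous_sin.
  apply: pair_continuous => t.
    apply: cvgB; apply: cvgM; [exact: cvg_cst|exact: ccos|exact: cvg_cst|exact: csin].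
  apply: cvgD; apply: cvgM; [exact: cvg_cst|exact: csin|exact: cvg_cst|exact: ccos].
have c2 : continuous ((fun t j => a.1.2 j + v j t) :
    X -> prod_topology (fun _ : 'I_q => R : realType)).
  apply: prod_topology_continuous => j t.
  by apply: cvgD; [exact: cvg_cst | exact: cv].
have c3 : continuous ((fun=> (a.2 : F) + 0) : X -> discrete_topology F).
  exact: cst_continuous.
exact: (pair_continuous (pair_continuous c1 c2) c3).
Qed.

(** The path t |-> phi + exp(t (s, v)) stays in H_S because [s] and [v] vanish on S; it starts at
    phi and ends at the given point. *)
Lemma component_HS_exp S phi (s : 'I_p -> V -> R) (v : 'I_q -> V -> R) :
  HS S phi ->
  (forall i, {morph s i : x y / x + y}) -> (forall j, {morph v j : x y / x + y}) ->
  (forall i k, k \in S -> s i A`_k = 0) -> (forall j k, k \in S -> v j A`_k = 0) ->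
  connected_component (HS S) phi
    ((fun x => Gadd (phi x) (Gexp (s^~ x) (v^~ x) 0)) : TT).
Proof.
move=> HSphi sD vD sS vS.
pose g (t : R) : TT := fun x => Gadd (phi x)
  (Gexp (fun i => t * s i x) (fun j => t * v j x) 0).
have -> : ((fun x => Gadd (phi x) (Gexp (s^~ x) (v^~ x) 0)) : TT) = g 1.
  apply/funext => x; rewrite /g; congr Gadd.
  by apply: Gamb_eq => [i|j|] //=; rewrite mul1r.
have g0 : g 0 = phi.
  apply/funext => x; rewrite -[RHS]Gadd0 /g; congr Gadd.
  by apply: Gamb_eq => [i|j|] //=; rewrite mul0r ?cis0.
apply: (@connected_component_max _ _ (g @` setT)); last by exists 1.
- by exists 0.
- move=> _ [t _ <-]; have [Tphi phiS] := HSphi; split.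
    apply: (@Tset_add _ _ _ _ _ phi); first exact: Tphi.
    apply: (@Tset_exp _ _ _ _ _ (fun i x => t * s i x) (fun j x => t * v j x)
      (fun=> 0)) => [i x y|j x y|x y]; last by rewrite addr0.
      by rewrite sD mulrDr.
    by rewrite vD mulrDr.
  move=> k kS; rewrite /g phiS //; apply: Gamb_eq => [i|j|] /=.
  + by rewrite sS // mulr0 cis0 cmul1.
  + by rewrite vS // mulr0 addr0.
  + by rewrite addr0.
- apply: connected_continuous_connected.
    by apply/connected_intervalP => x y _ _ z _.
  apply: continuous_subspaceT; apply: prod_topology_continuous => x.
  by apply: Gadd_exp_continuous => i; apply: mulrr_continuous.
Qed.

End Components.

(** * Components of H_S described through a splitting of Gamma *)

Section ComponentsSplit.
Context {R : realType} {p q : nat} {F : finZmodType} {V : zmodType}.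
Local Notation TT := (prod_topology (fun _ : V => Gamb R p q F)).
Local Notation Gzero := (@Gzero R p q F).
Local Notation Tset := (@Tset R p q F V).
Context {A : seq V}.
Implicit Types S : {set 'I_(size A)}.
Implicit Types (phi psi : TT).
Local Notation HS S := (@HS R p q F V A S).
Hypothesis fgV : fin_gen (Gamma := V).

Lemma torQ_splits S : exists d e c, @splits V (torQ S) d e c.
Proof. exact: fin_gen_splits fgV (torQ_subgroup S) (@torQ_saturated V A S). Qed.

(** When [c] comes from a splitting, this is the additive form that vanishes on M and takes the
    value [a j] on the j-th basis element. *)
Definition coord_form d (c : {additive V -> 'rV[int]_d}) (a : 'I_d -> R) x : R :=
  \sum_j a j * (c x 0 j)%:~R.

Lemma coord_formD d (c : {additive V -> 'rV[int]_d}) a :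
  {morph coord_form c a : x y / x + y}.
Proof.
move=> x y; rewrite /coord_form -big_split; apply: eq_bigr => j _ /=.
by rewrite raddfD mxE intrD mulrDr.
Qed.

Lemma coord_form_eq0 d (c : {additive V -> 'rV[int]_d}) a x :
  c x = 0 -> coord_form c a x = 0.
Proof. by move=> cx; rewrite /coord_form big1 // => j _; rewrite cx mxE mulr0. Qed.

Lemma coord_form_delta d (c : {additive V -> 'rV[int]_d}) a x j :
  c x = delta_mx 0 j -> coord_form c a x = a j.
Proof.
move=> cx; rewrite /coord_form (bigD1 j) //= cx mxE !eqxx mulr1.
by rewrite big1 ?addr0 // => k /negPf kj; rewrite mxE kj andbF mulr0.
Qed.

Lemma splits_eq S d e (c : {additive V -> 'rV[int]_d}) phi psi :
  splits (torQ S) e c -> Tset phi -> Tset psi ->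
  (forall x, torQ S x -> phi x = psi x) -> (forall j, phi (e j) = psi (e j)) ->
  phi = psi.
Proof.
move=> [Se _ _] Tphi Tpsi eqS eqe; apply/funext => x.
have subE := Tset_eq_subgroup Tphi Tpsi.
rewrite -[x](subrK (lin_comb e (c x))).
apply: (subgroupD subE); first exact/eqS/Se.
by apply: (subgroup_sum subE) => j _; apply: (subgroupMz subE); apply: eqe.
Qed.

Lemma component_HSP S phi psi : HS S phi -> HS S psi ->
  connected_component (HS S) phi psi <->
  (forall x, torQ S x -> phi x = psi x) /\ (forall x, (phi x).2 = (psi x).2).
Proof.
move=> HSphi HSpsi; split=> [|[eqS eq2]]; first exact: component_HS_invariant.
have [Tphi _] := HSphi; have [Tpsi _] := HSpsi.
have [d [e [c [Se Sc ce]]]] := torQ_splits S.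
(* The differences on the basis have zero F-part, so they are exponentials; interpolating their
   logarithms linearly gives the tangent direction from phi to psi. *)
pose delta j := Gadd (psi (e j)) (Gopp (phi (e j))).
have delta_exp j : exists ab : ('I_p -> R) * ('I_q -> R), delta j = Gexp ab.1 ab.2 0.
  have [|a [b abE]] := @Gexp_onto R p q F (delta j).
    by apply: Gset_add; [apply: (proj1 Tpsi) | apply/Gset_opp/(proj1 Tphi)].
  by exists (a, b); rewrite abE /= eq2 subrr.
have [ab abE] := choice delta_exp.
pose s i := coord_form c (fun j => (ab j).1 i).
pose v i := coord_form c (fun j => (ab j).2 i).
have cS k : k \in S -> c A`_k = 0 by move=> kS; apply/Sc/span_torQ/span_gen.
have conn := @component_HS_exp R p q F V A S phi s v HSphi
  (fun i => coord_formD _ _) (fun j => coord_formD _ _)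
  (fun i k kS => coord_form_eq0 _ (cS k kS)) (fun i k kS => coord_form_eq0 _ (cS k kS)).
rewrite -[psi](_ : (fun x => Gadd (phi x) (Gexp (s^~ x) (v^~ x) 0)) = psi) //.
have [Tchi _] := connected_component_sub conn.
apply: (@splits_eq S d e c) => // [x Sx|j].
  rewrite -eqS // -[RHS]Gadd0; congr Gadd; move/Sc: Sx => cx.
  by apply: Gamb_eq => [i|i|] //=; rewrite /s /v coord_form_eq0 // cis0.
have -> : Gexp (s^~ (e j)) (v^~ (e j)) 0 = delta j.
  by rewrite abE; apply: Gamb_eq => [i|i|] //=; rewrite /s /v (coord_form_delta _ (ce j)).
rewrite /delta GaddC -GaddA [Gadd (Gopp _) _]GaddC GaddV ?Gadd0 //.
exact: (proj1 Tphi).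
Qed.

(** If alpha had a nonzero coordinate modulo [torQ S], one could move inside C in that direction and
    change the value at alpha. *)
Lemma SC_torQ S (C : set TT) i : (0 < p + q)%N -> components (HS S) C ->
  i \in SC A C -> torQ S A`_i.
Proof.
move=> pq0 [phi [HSphi ->]]; rewrite inE => /asboolP CH.
have [d [e [c [_ Sc _]]]] := torQ_splits S.
apply/Sc/eqP/negPn/negP => cN0.
have [j cj] : exists j, c A`_i 0 j != 0.
  apply/existsP; apply: contra_neqT cN0 => /existsPn c0.
  by apply/rowP => j; have := c0 j; rewrite negbK mxE => /eqP.
pose m : R := (c A`_i 0 j)%:~R; have m0 : m != 0 by rewrite intr_eq0.
(* Moving phi along the j-th coordinate by a half turn in every circle factor
   and by 1 in every real factor leaves the kernel of evaluation at A`_i. *)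
pose a (t : R) := coord_form c (fun k => if k == j then t / m else 0).
have aE t : a t A`_i = t.
  rewrite /a /coord_form (bigD1 j) //= eqxx divfK // big1 ?addr0 //.
  by move=> k /negPf ->; rewrite mul0r.
have cS k : k \in S -> c A`_k = 0 by move=> kS; apply/Sc/span_torQ/span_gen.
have conn := @component_HS_exp R p q F V A S phi (fun=> a pi) (fun=> a 1) HSphi
  (fun i => coord_formD _ _) (fun j => coord_formD _ _)
  (fun i k kS => coord_form_eq0 _ (cS k kS)) (fun i k kS => coord_form_eq0 _ (cS k kS)).
have [_] := CH _ conn.
have [_ ->] := CH _ (connected_component_refl HSphi).
rewrite GaddC Gadd0 => -[/funeqP c1 /funeqP c2].
(* This is where g > 0 enters: a circle factor would give cos(pi) = 1, a real factor 1 = 0. *)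
case: (posnP p) => [p0|p0]; last first.
  have [/eqP] := c1 (Ordinal p0); rewrite aE cospi.
  by rewrite eq_sym -subr_eq0 opprK -mulr2n pnatr_eq0.
rewrite p0 in pq0; have /eqP := c2 (Ordinal pq0).
by rewrite aE oner_eq0.
Qed.

(** [SC A C] lies between S and [torQ S], which have equal rank. Hence [dimC] has the value
    g(r_Gamma - r_S) for every S having C as a component of H_S. *)
Lemma SC_rank S (C : set TT) : (0 < p + q)%N -> components (HS S) C ->
  rkS (SC A C) = rkS S.
Proof.
move=> pq0 compC.
have subC : S \subset SC A C.
  apply/fintype.subsetP => i iS; rewrite inE; apply/asboolP => psi.
  have [phi [_ ->]] := compC; move=> /connected_component_sub [Tpsi].
  by move=> /(_ i iS).
have [r [e0 [c0 sp0]]] := fin_gen_splits fgV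
  (saturation_subgroup subgroup0) (@saturation_saturated V [set 0]).
apply/eqP; rewrite eqn_leq !(rkS_torQ sp0) // => i.
  by move=> iS; apply/span_torQ/span_gen/(fintype.subsetP subC).
exact: SC_torQ.
Qed.

End ComponentsSplit.

(** * Counting components *)

Lemma card_fsetM (T1 T2 : choiceType) (X : {fset T1}) (Y : {fset T2}) :
  #|` (X `*` Y)%fset| = (#|` X| * #|` Y|)%N.
Proof.
rewrite -(size_allpairs pair); apply/perm_size/uniq_perm => //.
  by apply: allpairs_uniq => //= -[x y] [x' y'] _ _ [-> ->].
move=> [x y]; rewrite in_fsetM /=; apply/andP/allpairsP => [[xX yY]|].
  by exists (x, y).
by move=> [[x' y'] [/= xX yY [-> ->]]].
Qed.

Lemma card_fset_setT (T : finType) : #|` fset_set [set: T]| = #|T|.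
Proof.
rewrite cardE; apply/perm_size/uniq_perm => //; first exact: enum_uniq.
move=> x; rewrite in_fset_set ?mem_enum; last exact: finite_finset.
by rewrite mem_set.
Qed.

Section Counting.
Context {R : realType} {p q : nat} {F : finZmodType} {V : zmodType}.
Local Notation TT := (prod_topology (fun _ : V => Gamb R p q F)).
Local Notation Gzero := (@Gzero R p q F).
Local Notation Tset := (@Tset R p q F V).
Context {A : seq V}.
Implicit Types S : {set 'I_(size A)}.
Implicit Types (phi psi : TT).
Local Notation HS S := (@HS R p q F V A S).
Local Notation HomTorQ S := (@HomTorQ R p q F V A S).
Hypothesis fgV : fin_gen (Gamma := V).

Lemma Tset_snd_subgroup phi psi : Tset phi -> Tset psi ->
  is_subgroup [set x | (phi x).2 = (psi x).2].
Proof.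
move=> Tphi Tpsi; split=> [|x y /= xE yE]; first by rewrite /= !Tset0.
rewrite (proj2 Tphi) (proj2 Tpsi) /=.
by rewrite [phi (- y)]TsetN // [psi (- y)]TsetN //= xE yE.
Qed.

(** * Representatives of the components of H_S *)

Section Extension.
Variables (S : {set 'I_(size A)}) (d : nat) (e : 'I_d -> V)
  (c : {additive V -> 'rV[int]_d}).
Hypothesis spS : splits (torQ S) e c.

(** The projection of Gamma onto [torQ S] along the [e i]. *)
Let retr x := x - lin_comb e (c x).

Let retr_torQ x : torQ S (retr x).
Proof. by have [Se _ _] := spS; apply: Se. Qed.

Let retr_id x : torQ S x -> retr x = x.
Proof.
have [_ Sc _] := spS; move=> /Sc cx; rewrite /retr /lin_comb big1 ?subr0 // => i _.
by rewrite cx mxE mulr0z.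
Qed.

(** The representative of the component indexed by (f, w): it is f on [torQ S], and sends [e j] to
    the element of G with trivial circle and real parts and F-part [w j]. Precomposing with the
    projection is needed since f is set to zero outside [torQ S]. *)
Definition extend (f : V -> Gamb R p q F) (w : {ffun 'I_d -> F}) : TT :=
  fun x => Gadd (f (x - lin_comb e (c x)))
    (Gexp (fun=> 0) (fun=> 0) (\sum_j w j *~ c x 0 j)).

Lemma retract_Tset f : HomTorQ S f -> Tset ((fun x => f (retr x)) : TT).
Proof.
move=> [Gf [Df _]]; split=> [x|x y]; first exact: Gf.
rewrite -Df //; congr f; rewrite /retr raddfD /=.
rewrite (_ : lin_comb e _ = lin_comb e (c x) + lin_comb e (c y)) ?opprD 1?addrACA //.
rewrite /lin_comb -big_split; apply: eq_bigr => j _.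
by rewrite mxE mulrzDr.
Qed.

Lemma retract_HS f : HomTorQ S f -> HS S ((fun x => f (retr x)) : TT).
Proof.
move=> Hf; split=> [|k kS]; first exact: retract_Tset.
have Sk := span_gen kS; rewrite retr_id; last exact: span_torQ.
by have [_ [_ [-> //]]] := Hf.
Qed.

Lemma extend_HS f w : HomTorQ S f -> HS S (extend f w).
Proof.
move=> Hf; have [Tf fS] := retract_HS Hf; split.
  apply: (Tset_add Tf); apply: (@Tset_exp _ _ _ _ _ (fun=> fun=> 0) (fun=> fun=> 0)
    (fun x => \sum_j w j *~ c x 0 j)) => [i x y|j x y|x y]; rewrite ?addr0 //.
  by rewrite -big_split; apply: eq_bigr => j _; rewrite raddfD mxE mulrzDr.
move=> k kS; rewrite /extend [f _]fS // GaddC Gadd0.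
have [_ Sc _] := spS; have /Sc ck : torQ S A`_k by exact/span_torQ/span_gen.
apply: Gamb_eq => [i|j|] //=; first by rewrite cis0.
by rewrite big1 // => j _; rewrite ck mxE mulr0z.
Qed.

Lemma extend_torQ f w x : torQ S x -> extend f w x = f x.
Proof.
move=> Sx; rewrite -[RHS]Gadd0 /extend -/(retr x) retr_id //; congr Gadd.
apply: Gamb_eq => [i|j|] //=; first by rewrite cis0.
have [_ Sc _] := spS; move/Sc: Sx => cx.
by rewrite big1 // => j _; rewrite cx mxE mulr0z.
Qed.

Lemma extend_snd f w j : HomTorQ S f -> (extend f w (e j)).2 = w j.
Proof.
move=> Hf; have [_ _ ce] := spS; rewrite /extend /= ce lin_comb_delta subrr.
have [_ [_ [f0 _]]] := Hf; rewrite (f0 0 (proj1 (span_subgroup S))).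
rewrite /= add0r (bigD1 j) //= big1 ?addr0 => [|i /negPf ij].
  by rewrite mxE !eqxx mulr1z.
by rewrite mxE ij andbF mulr0z.
Qed.

Lemma restrict_HomTorQ phi : HS S phi ->
  HomTorQ S (fun x => if `[< torQ S x >] then phi x else Gzero).
Proof.
move=> HSphi; have [[Gphi Dphi] _] := HSphi; split; last split; last split.
- by move=> x; case: ifP => _; [apply: Gphi | apply: Gset0].
- move=> x y Sx Sy; rewrite !asboolT //.
  exact: (subgroupD (torQ_subgroup S)).
- by move=> x Sx; rewrite asboolT ?(HS_span HSphi) //; apply: span_torQ.
- by move=> x nSx; rewrite asboolF.
Qed.

Definition component_of (fw : (V -> Gamb R p q F) * {ffun 'I_d -> F}) : set TT :=
  connected_component (HS S) (extend fw.1 fw.2).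

(** Any phi in H_S has the same restriction to [torQ S] and the same F-part as the extension built
    from its own data, so both lie in one component. *)
Lemma components_image :
  components (HS S) = component_of @` (HomTorQ S `*` setT).
Proof.
apply/seteqP; split=> [_ [phi [HSphi ->]]|_ [[f w] [/= Hf _] <-]]; last first.
  by exists (extend f w); split=> //; apply: extend_HS.
have Hf := restrict_HomTorQ HSphi; set f := (fun x => _) in Hf.
pose w := [ffun j => (phi (e j)).2 : F].
have fE x : torQ S x -> f x = phi x by move=> Sx; rewrite /f /= asboolT.
exists (f, w) => //; rewrite /component_of /=; apply: same_connected_component.
have HSext := extend_HS w Hf.
have eq_torQ x : torQ S x -> extend f w x = phi x.
  by move=> Sx; rewrite extend_torQ // fE.
have eq_gen j : (extend f w (e j)).2 = (phi (e j)).2 by rewrite extend_snd // ffunE.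
apply/component_HSP => //; split=> // x.
have subE := Tset_snd_subgroup (proj1 HSext) (proj1 HSphi).
rewrite -[x](subrK (lin_comb e (c x))).
apply: (subgroupD subE); first by congr snd; apply/eq_torQ/retr_torQ.
by apply: (subgroup_sum subE) => j _; apply: (subgroupMz subE); apply: eq_gen.
Qed.

Lemma component_of_inj : {in HomTorQ S `*` setT &, injective component_of}.
Proof.
move=> [f w] [f' w'] /set_mem[/= Hf _] /set_mem[/= Hf' _] eqC.
have HSe := extend_HS w Hf; have HSe' := extend_HS w' Hf'.
have : connected_component (HS S) (extend f w) (extend f' w').
  rewrite -[connected_component _ _]/(component_of (f, w)) eqC.
  exact: connected_component_refl.
move/component_HSP => -[] // eqS eq2; congr (_, _).
  apply/funext => x; have [Sx|nSx] := pselect (torQ S x).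
    by rewrite -(extend_torQ f w Sx) eqS // extend_torQ.
  have [_ [_ [_ ->]]] := Hf => //.
  by have [_ [_ [_ ->]]] := Hf'.
by apply/ffunP => j; rewrite -(extend_snd w j Hf) eq2 extend_snd.
Qed.

(** An element is determined by its values at the projected generators; there the circle coordinates
    are roots of unity and the real ones vanish. Finiteness is what makes [fset_set] in [mS] an
    honest count. *)
Lemma finite_HomTorQ : finite_set (HomTorQ S).
Proof.
have [s gen_s] := fgV.
have [n nP] := choice (fun k : 'I_(size s) => retr_torQ s`_k).
(* A common exponent for all projected generators modulo the span of S. *)
pose N := (\prod_k n k)%N.
have N0 : (0 < N)%N by apply: prodn_gt0 => k; have [] := nP k.
have NP (k : 'I_(size s)) : Defs.span S (retr s`_k *+ N).
  rewrite /N (bigD1 k) //= mulrnA; apply: (subgroupMn (span_subgroup S)).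
  by have [] := nP k.
have [r rP] := @finite_unity_roots R N N0.
(* Circle coordinates are recorded by their position in the list [r] of N-th roots of unity; the
   successor in the index type is there for [inord]. *)
pose code (f : V -> Gamb R p q F) :
    {ffun 'I_(size s) * 'I_p -> 'I_(size r).+1} * {ffun 'I_(size s) -> F} :=
  ([ffun ki : 'I_(size s) * 'I_p =>
      inord (index ((f (retr s`_(ki.1 : 'I_(size s)))).1.1 ki.2) r)],
   [ffun k : 'I_(size s) => (f (retr s`_k)).2 : F]).
have code_inj : {in HomTorQ S &, injective code}.
  move=> f f' /set_mem Hf /set_mem Hf' [/ffunP code1 /ffunP code2].
  have torsion_gen g (k : 'I_(size s)) : HomTorQ S g ->
      (forall i, (g (retr s`_k)).1.1 i \in r) /\ (forall j, (g (retr s`_k)).1.2 j = 0).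
    move=> Hg; have [] := HS_torsion (retract_HS Hg) N0 (NP k).
    rewrite retr_id // => g1 g2; split=> // i; exact/rP/g1.
  have eq_gen (k : 'I_(size s)) : f (retr s`_k) = f' (retr s`_k).
    have [f1 f2] := torsion_gen f k Hf; have [f1' f2'] := torsion_gen f' k Hf'.
    apply: Gamb_eq => [i|j|]; first 1 last.
    - by rewrite f2 f2'.
    - by have := code2 k; rewrite !ffunE.
    have := code1 (k, i); rewrite !ffunE /= => /(congr1 val) /=.
    rewrite !inordK ?ltnS ?index_size // => eqi.
    by rewrite -(nth_index 0 (f1 i)) eqi nth_index.
  have eq_retr x : f (retr x) = f' (retr x).
    have subE := Tset_eq_subgroup (retract_Tset Hf) (retract_Tset Hf').
    have [a ->] := gen_s x.
    apply: (subgroup_sum subE) => k _; apply: (subgroupMz subE); exact: eq_gen.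
  apply/funext => x; have [Sx|nSx] := pselect (torQ S x).
    by rewrite -(retr_id Sx).
  have [_ [_ [_ ->]]] := Hf => //.
  by have [_ [_ [_ ->]]] := Hf'.
rewrite -(eq_finite_set (inj_card_eq code_inj)).
exact: finite_finset.
Qed.

Lemma card_components_splits : finite_set (components (HS S)) /\
  #|` fset_set (components (HS S))| = (@mS R p q F V A S * #|F| ^ d)%N.
Proof.
have finD : finite_set (HomTorQ S `*` [set: {ffun 'I_d -> F}]).
  by apply: finite_setX; [apply: finite_HomTorQ | apply: finite_finset].
split; first by rewrite components_image; apply: finite_image.
rewrite components_image fset_set_image // card_in_imfset /=; last first.
  move=> x y; rewrite !in_fset_set //; exact: component_of_inj.
rewrite fset_setX ?card_fsetM ?card_fset_setT ?card_ffun ?card_ord //.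
  exact: finite_HomTorQ.
exact: finite_finset.
Qed.

End Extension.

Lemma card_components S : finite_set (components (HS S)) /\
  #|` fset_set (components (HS S))| =
    (@mS R p q F V A S * #|F| ^ (@rkG V - rkS S))%N.
Proof.
have [d [e [c spS]]] := torQ_splits fgV S.
have [r [e0 [c0 sp0]]] := fin_gen_splits fgV
  (saturation_subgroup subgroup0) (@saturation_saturated V [set 0]).
rewrite (rkG_torQ sp0 spS) addKn; exact: card_components_splits spS.
Qed.

End Counting.

(** * Moebius inversion *)

Lemma sum_fset_set_cond (T : choiceType) (M : zmodType) (X Y : set T) (a : M) :
  finite_set X ->
  \sum_(E <- fset_set X | `[< Y E >]) a = a *+ #|` fset_set (X `&` Y)|.
Proof.
move=> finX; rewrite big_const_seq iter_addr addr0 -size_filter; congr (_ *+ _).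
apply/perm_size/uniq_perm => //; first by rewrite filter_uniq.
have finXY : finite_set (X `&` Y) by apply: finite_setIl.
move=> E; rewrite mem_filter !in_fset_set //.
apply/andP/idP => [[/asboolP YE /set_mem XE]|/set_mem[XE YE]].
  exact/mem_set.
by split; [apply/asboolP | apply/mem_set].
Qed.

(** The sum is the expansion of a product over all i whose factor is 0 for i in B and 1
    otherwise. *)
Lemma sum_sign_subsets (T : finType) (B : {set T}) :
  \sum_(S : {set T} | S \subset B) (-1) ^+ #|S| = (B == finset.set0)%:R :> int.
Proof.
pose f i : int := if i \in B then -1 else 0.
(* Expanding the product gives 0 at every S not contained in B. *)
transitivity (\prod_i (f i + 1)).
  rewrite bigA_distr /= big_mkcond; apply: eq_bigr => S _.
  rewrite -big_mkcond /=; case: ifPn => [/fintype.subsetP SB|/fintype.subsetPn[i iS iB]].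
    rewrite (eq_bigr (fun=> -1)) ?prodr_const // => i /SB iB.
    by rewrite /f iB.
  by rewrite (bigD1 i) //= /f (negPf iB) mul0r.
have [B0|/finset.set0Pn[i iB]] := eqVneq B finset.set0.
  by rewrite big1 // => i _; rewrite /f B0 inE add0r.
by rewrite (bigD1 i) //= /f iB addNr mul0r.
Qed.

(** The signs combine to exponent a + (a - r) + (s - r), which has the parity of s; the powers of X
    add up to g - r. The inequalities make the natural subtractions genuine. *)
Lemma tutte_term_sign (g a r s m : nat) : (r <= a)%N -> (a <= g)%N -> (r <= s)%N ->
  (-1) ^+ a *: 'X^(g - a) *
    (m%:R * (1 - 'X - 1) ^+ (a - r) * (0 - 1) ^+ (s - r)) =
  ((-1) ^+ s * m%:R) *: 'X^(g - r) :> {poly int}.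
Proof.
move=> ra ag rs; have -> : (g - r = (g - a) + (a - r))%N by lia.
have -> : s = (r + (s - r))%N by lia.
rewrite addKn; move: (s - r)%N => l; have -> : a = (r + (a - r))%N by lia.
rewrite addKn; move: (a - r)%N (g - (r + _))%N => k j.
rewrite addrAC subrr !sub0r [(- 'X) ^+ _]exprNn -!mul_polyC !exprD polyCM !polyCM !rmorphXn /=.
rewrite polyCN polyC1 polyC_natr.
have sign2 : (-1) ^+ k * (-1) ^+ k = 1 :> {poly int}.
  by rewrite -expr2 sqrr_sign.
move: sign2; move: ((-1) ^+ k) ((-1) ^+ r) ((-1) ^+ l) ('X^k) ('X^j) => x y z t u xx.
transitivity ((x * x) * (y * z * m%:R * (u * t))); first by ring.
by rewrite xx mul1r.
Qed.

Section Moebius.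
Context {R : realType} {p q : nat} {F : finZmodType} {V : zmodType}.
Local Notation TT := (prod_topology (fun _ : V => Gamb R p q F)).
Local Notation Tset := (@Tset R p q F V).
Context {A : seq V}.
Implicit Types S : {set 'I_(size A)}.
Implicit Types (C D E : set TT).
Local Notation HS S := (@HS R p q F V A S).
Local Notation L := (@Lposet R p q F V A).
Hypothesis fgV : fin_gen (Gamma := V).
Hypothesis pq0 : (0 < p + q)%N.

Lemma finite_Lposet : finite_set L.
Proof.
have -> : L = \bigcup_(S in [set: {set 'I_(size A)}]) components (HS S).
  by apply/seteqP; split=> [C [S CS]|C [S _ CS]]; exists S.
apply: bigcup_finite => [|S _]; first exact: finite_finset.
by have [] := card_components (R := R) (p := p) (q := q) (F := F) fgV S.
Qed.

Lemma sub_HS D S : L D -> (D `<=` HS S) <-> (S \subset SC A D).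
Proof.
move=> [S' [phi [HSphi DE]]]; split=> [DH|/fintype.subsetP sub psi Dpsi].
  apply/fintype.subsetP => i iS; rewrite inE; apply/asboolP => psi /DH[Tpsi].
  by move/(_ i iS).
split=> [|i /sub].
  by move: Dpsi; rewrite DE => /connected_component_sub[].
by rewrite inE => /asboolP/(_ _ Dpsi)[].
Qed.

(** D is connected, so it lies in the component of any of its points, and distinct components are
    disjoint. The singleton form lets the cardinality be read off. *)
Lemma component_above D S : L D -> D `<=` HS S ->
  exists E, [set E | D `<=` E /\ components (HS S) E] = [set E].
Proof.
move=> [S' [phi [HSphi ->]]] DH.
have Dphi := connected_component_refl HSphi.
exists (connected_component (HS S) phi); apply/seteqP; split=> [E [DE [psi [HSpsi EE]]]|_ ->].
  rewrite /= EE; apply: same_connected_component.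
  by rewrite -EE; apply: DE.
split; last by exists phi; split=> //; apply: DH.
apply: connected_component_max => //; exact: component_connected.
Qed.

Lemma HS0 : HS finset.set0 = Tset.
Proof. by apply/seteqP; split=> [phi []|phi Tphi] //; split=> // i; rewrite inE. Qed.

Lemma topC_component D phi : L D -> D phi -> topC D = connected_component Tset phi.
Proof.
move=> [S [chi [HSchi ->]]] Dphi.
have sub psi : connected_component (HS S) chi psi -> connected_component Tset chi psi.
  apply: connected_component_max; first exact: connected_component_refl.
    by move=> xi /connected_component_sub[].
  exact: component_connected.
have topE psi : connected_component (HS S) chi psi ->
    connected_component Tset psi = connected_component Tset chi.
  by move=> /sub/same_connected_component.
apply/seteqP; split=> [xi [psi [Cpsi]]|xi].
  by rewrite (topE psi Cpsi) (topE phi Dphi).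
by rewrite (topE phi Dphi); exists chi; split=> //; apply: connected_component_refl.
Qed.

Lemma Lposet_nonempty D : L D -> exists phi, D phi /\ Tset phi.
Proof.
move=> [S [phi [HSphi ->]]]; exists phi; split; last by case: HSphi.
exact: connected_component_refl.
Qed.

Lemma components_topC D : L D -> components (HS finset.set0) (topC D).
Proof.
move=> LD; have [phi [Dphi Tphi]] := Lposet_nonempty LD.
by rewrite (topC_component LD Dphi) HS0; exists phi.
Qed.

Lemma topC_mono D E : L D -> L E -> D `<=` E -> topC D = topC E.
Proof.
move=> LD LE DE; have [phi [Dphi Tphi]] := Lposet_nonempty LD.
by rewrite (topC_component LD Dphi) (topC_component LE (DE _ Dphi)).
Qed.

Lemma sub_topC D : L D -> D `<=` topC D.
Proof.
move=> [S [chi [HSchi DE]]] phi Dphi; exists phi; split=> //.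
move: Dphi; rewrite DE => /connected_component_sub[Tphi _].
exact: connected_component_refl.
Qed.

Lemma component_HS0 D : components (HS finset.set0) D -> topC D = D.
Proof.
move=> cD; have LD : L D by exists finset.set0.
case: cD => phi; rewrite HS0 => -[Tphi DE].
rewrite (topC_component (phi := phi) LD) //.
by rewrite DE; apply: connected_component_refl.
Qed.

(** The order is reverse inclusion, so these are the elements below or equal to D in L. *)
Definition up D := [set E | L E /\ D `<=` E].

Lemma finite_up D : finite_set (up D).
Proof. by apply: sub_finite_set finite_Lposet => E []. Qed.

Definition signed_sum E : int :=
  \sum_(S : {set 'I_(size A)} | `[< components (HS S) E >]) (-1) ^+ #|S|.

(** After exchanging the sums, S contributes its sign once if D lies in H_S, and not at all
    otherwise. *)
Lemma sum_signed_sum_up D : L D ->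
  \sum_(E \in up D) signed_sum E = (SC A D == finset.set0)%:R.
Proof.
move=> LD; rewrite fsbig_finite; last exact: finite_up.
rewrite (exchange_big_dep predT) //= -sum_sign_subsets [RHS]big_mkcond /=.
apply: eq_bigr => S _; rewrite sum_fset_set_cond; last exact: finite_up.
have -> : up D `&` (components (HS S)) = [set E | D `<=` E /\ components (HS S) E].
  by apply/seteqP; split=> [E [[_ DE] cE]|E [DE cE]] //; split=> //; split=> //; exists S.
case: ifPn => [/(sub_HS _ LD) DS|/negP nsub].
  by have [E ->] := component_above LD DS; rewrite fset_set1 cardfs1.
rewrite [X in fset_set X](_ : _ = set0) ?fset_set0 ?cardfs0 //.
apply/seteqP; split=> // E [DE [phi [_ EE]]]; apply: nsub.
by apply/(sub_HS _ LD) => psi /DE; rewrite EE; apply: connected_component_sub.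
Qed.

(** Both sides satisfy the same recursion: the indicator depends on [topC D] only, which is shared
    by all E containing D. The bound on n says that the recursion depth suffices. *)
Lemma mob_aux_signed_sum n D : L D -> (#|` fset_set (up D)| <= n)%N ->
  signed_sum D = (SC A (topC D) == finset.set0)%:R * mob_aux A n (topC D) D.
Proof.
elim: n D => [|n IH] D LD.
  rewrite leqn0 cardfs_eq0 => /eqP up0.
  have : D \in fset_set (up D) by rewrite in_fset_set; [apply/mem_set; split | apply: finite_up].
  by rewrite up0.
move=> card_up; have := sum_signed_sum_up LD.
rewrite (fsbigD1 D); [|exact: finite_up|by split].
(* Every E in L containing D lies in [topC D], so this is the whole half-open interval of the
   recursion. *)
have -> : up D `\ D = [set E | L E /\ Lle (topC D) E /\ Lle E D /\ E <> D].
  apply/seteqP; split=> [E [[LE DE] ED]|E [LE [_ [DE ED]]]]; split=> //.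
  by split=> //; rewrite (topC_mono LD LE DE); apply: sub_topC.
(* If D is not a component of T, it is a component of H_S with S nonempty, so the alternating sum
   vanishes at D. *)
have topD : topC D <> D -> SC A D != finset.set0.
  move=> topND; case: (LD) => S cS; apply/eqP => SC0; apply: topND.
  apply: component_HS0; suff <- : S = finset.set0 by [].
  apply/eqP; rewrite -finset.subset0 -SC0; apply/(sub_HS _ LD).
  by case: cS => phi [_ ->]; apply: connected_component_sub.
rewrite /=; case: asboolP => [topE|topN].
  rewrite topE fsbig1 ?addr0 ?mulr1 // => E [_ [EtopD [DE ED]]].
  by case: ED; apply/seteqP; split.
rewrite asboolT; last exact: sub_topC.
rewrite (negPf (topD topN)) => /eqP; rewrite addr_eq0 => /eqP ->.
rewrite mulrN; congr (- _).
rewrite mulr_fsumr; apply: eq_fsbigr => E /set_mem[LE [_ [DE ED]]].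
rewrite (topC_mono LD LE DE); apply: IH => //.
(* The depth drops because D belongs to [up D] but not to [up E]. *)
rewrite -ltnS; apply: leq_trans card_up; apply: fproper_ltn_card.
have [finE finD] := (finite_up E, finite_up D).
rewrite fproperE; apply/andP; split; last apply/negP.
  by rewrite -(fset_set_sub finE finD) => G [LG EG]; split=> // phi /DE/EG.
rewrite -(fset_set_sub finD finE) => sub.
by case: ED; apply/seteqP; split=> //; have [] := sub D (conj LD (fun _ => id)).
Qed.

(** The definition of [scc] only excludes torsion elements; [SC_torQ] with the empty sublist shows
    that any alpha vanishing on a component of T is torsion. *)
Lemma sccE D : L D -> scc A (topC D) <-> SC A (topC D) = finset.set0.
Proof.
move=> LD; have ctop := components_topC LD; split=> [[_ noT]|SC0].
  apply/eqP/set0Pn => -[i iSC]; apply: noT; exists i; split; last first.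
    by move: iSC; rewrite inE => /asboolP.
  have [n [n0 [c xE]]] := SC_torQ fgV pq0 ctop iSC.
  by exists n; split=> //; rewrite xE big_set0.
split; first by rewrite -HS0.
case=> i [_ sub]; have : i \in SC A (topC D) by rewrite inE; apply/asboolP.
by rewrite SC0 inE.
Qed.

Lemma signed_sum_mobius D : L D ->
  signed_sum D = if D \in Lpar A then mobius A (topC D) D else 0.
Proof.
move=> LD; rewrite (@mob_aux_signed_sum (#|` fset_set L|).+1) //; last first.
  apply/leqW/fsubset_leq_card.
  by rewrite -(fset_set_sub (finite_up D) finite_Lposet) => E [].
case: ifPn => [/set_mem[_ /(sccE LD) ->]|]; first by rewrite eqxx mul1r.
case: eqP => [SC0|]; last by rewrite mul0r.
by move/negP; case; apply/mem_set; split=> //; apply/(sccE LD).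
Qed.

Lemma chi_par_sum : @chi_par R p q F V A =
  \sum_(S : {set 'I_(size A)})
    ((-1) ^+ #|S| * (@mS R p q F V A S * #|F| ^ (@rkG V - rkS S))%:R)%:P *
    'X^((p + q) * (@rkG V - rkS S)).
Proof.
have parE : Lpar A = L `&` (@Lpar R p q F V A) by apply/seteqP; split=> [C [LC sC]|C []].
rewrite /chi_par parE fsbig_mkcondr.
(* The sum may run over all of L, since [signed_sum] vanishes outside L^par. *)
transitivity (\sum_(C \in L) (signed_sum C)%:P * 'X^(dimC A C)).
  apply: eq_fsbigr => C /set_mem LC; rewrite signed_sum_mobius //.
  by case: ifP => //; rewrite mul0r.
rewrite fsbig_finite; last exact: finite_Lposet.
under eq_bigr => C _ do rewrite /signed_sum rmorph_sum mulr_suml.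
rewrite (exchange_big_dep predT) //=; apply: eq_bigr => S _.
(* For fixed S all components of H_S contribute the same monomial, so only their number matters. *)
pose a : {poly int} := ((-1) ^+ #|S|)%:P * 'X^((p + q) * (@rkG V - rkS S)).
rewrite (eq_bigr (fun=> a)) => [|C /asboolP cC]; last first.
  by rewrite /a /dimC (SC_rank fgV pq0 cC).
rewrite sum_fset_set_cond; last exact: finite_Lposet.
have -> : L `&` components (HS S) = components (HS S).
  by apply/seteqP; split=> [C []|C cC] //; split=> //; exists S.
have [_ ->] := card_components (R := R) (p := p) (q := q) (F := F) fgV S.
by rewrite /a polyCM mulrAC -[_ *+ _]mulr_natr polyC_natr.
Qed.

End Moebius.

Theorem theorem3p7 (R : realType) (Gamma : zmodType) (A : seq Gamma)
  (p q : nat) (F : finZmodType) :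
  @fin_gen Gamma -> (0 < p + q)%N ->
  @chi_par R p q F Gamma A =
  (@chiG R p q F Gamma A) \Po ((#|F|%:R : int) *: 'X^(p + q)).
Proof.
move=> fgV pq0; rewrite chi_par_sum //.
have [r [e0 [c0 sp0]]] := fin_gen_splits fgV
  (saturation_subgroup subgroup0) (@saturation_saturated Gamma [set 0]).
(* The bounds r_S <= r_A <= r_Gamma and r_S <= #S feed the sign computation. *)
have rk_le_A (S : {set 'I_(size A)}) : (rkS S <= rkS [set: 'I_(size A)]%SET)%N.
  by apply: (rkS_torQ sp0) => i _; apply/span_torQ/span_gen; rewrite inE.
have rkA_le : (rkS [set: 'I_(size A)]%SET <= @rkG Gamma)%N.
  have [d [e [c spS]]] := torQ_splits fgV [set: 'I_(size A)]%SET.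
  by rewrite (rkG_torQ sp0 spS) leq_addr.
have term (S : {set 'I_(size A)}) :
    ((-1) ^+ rkS [set: 'I_(size A)]%SET *: 'X^(@rkG Gamma - rkS [set: 'I_(size A)]%SET)) *
    ((@mS R p q F Gamma A S)%:R *
      (1 - 'X - 1) ^+ (rkS [set: 'I_(size A)]%SET - rkS S) *
      (0 - 1) ^+ (#|S| - rkS S)) =
    ((-1) ^+ #|S| * (@mS R p q F Gamma A S)%:R) *: 'X^(@rkG Gamma - rkS S) :> {poly int}.
  have le1 := rk_le_A S; have le2 := rkS_le_card sp0 S.
  exact: tutte_term_sign.
rewrite /chiG /tutteG mulr_sumr raddf_sum; apply: eq_bigr => S _ /=.
(* Substituting #F t^g in the monomial of degree r_Gamma - r_S produces the power of #F found in the
   component count. *)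
rewrite term comp_polyZ rmorphXn /= comp_polyX exprZn -exprM -natrX scalerA.
by rewrite natrM mulrA mul_polyC.
Qed.
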